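(* Let $P$ be a regular power series method, let $r\ge 1$ be a fixed integer and let $[a,b]$ be a compact interval. Let $(G_j)_{j\in\mathbb{N}_0}$ be a sequence of positive linear operators $G_j:C[a,b]\to C[a,b]$ of the form $$G_j(\psi;x)=\sum_{k=0}^\infty\rho_{j,k}(x)\,\psi(x_{j,k}),\qquad x\in[a,b],$$ with nodes $x_{j,k}\in[a,b]$ and with $G_j(1;x)=\sum_{k=0}^\infty\rho_{j,k}(x)=1$ for all $x\in[a,b]$. For $\psi\in C^r[a,b]$ define $$G_j^{[r]}(\psi;x)=\sum_{k=0}^\infty\sum_{\nu=0}^r\rho_{j,k}(x)\,\psi^{(\nu)}(x_{j,k})\,\frac{(x-x_{j,k})^\nu}{\nu!},\qquad x\in[a,b].$$ Suppose that $$st_P-\lim_{j\to\infty}\|G_j(\psi_\lambda)-\psi_\lambda\|=0\qquad\text{for }\lambda=1,2,3,$$ where $\psi_1(x)=1$, $\psi_2(x)=x$, $\psi_3(x)=x^2$. Then for any $\psi\in C^r[a,b]$ with $\psi^{(r)}\in Lip_M(\alpha)$ (where $M>0$, $0<\alpha\le1$), we have $$st_P-\lim_{j\to\infty}\|G_j^{[r]}(\psi)-\psi\|=0.$$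
   Context: $\mathbb{N}_0$ is the set of non-negative integers. A power series method $P=(s_j)_{j\ge0}$ is a real sequence with $s_0>0$ and $s_1,s_2,\dots\ge 0$ such that the power series $s(t)=\sum_{j=0}^\infty s_jt^j$ has radius of convergence $R$ with $0<R\le\infty$. It is regular if and only if $\lim_{0<t\to R^-}\frac{s_jt^j}{s(t)}=0$ for every $j\in\mathbb{N}_0$. For $E\subset\mathbb{N}_0$, the $P$-density of $E$ is $\delta_P(E)=\lim_{0<t\to R^-}\frac{1}{s(t)}\sum_{j\in E}s_jt^j$, whenever this limit exists. A real sequence $(x_j)$ is $P$-statistically convergent to $L$, written $st_P-\lim_{j\to\infty}x_j=L$, if for every $\varepsilon>0$, $\delta_P(\{j\in\mathbb{N}_0:|x_j-L|\ge\varepsilon\})=0$. $C[a,b]$ is the space of real-valued continuous functions on $[a,b]$, $\|\cdot\|$ is the supremum norm on $[a,b]$, and $C^r[a,b]$ is the space of real-valued functions on $[a,b]$ continuously differentiable up to order $r$. $Lip_M(\alpha)$ is the set of continuous functions $\psi$ on $[a,b]$ with $|\psi(x)-\psi(y)|\le M|x-y|^\alpha$ for all $x,y\in[a,b]$. A linear operator is positive if it maps non-negative functions to non-negative functions. The series defining $G_j(\psi;x)$ is understood to converge for every $\psi\in C[a,b]$ and $x\in[a,b]$. *)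

(* Defs.v *)
From mathcomp Require Import all_boot all_order all_algebra.
From mathcomp Require Import all_classical all_reals all_analysis.
Set Implicit Arguments.
Unset Strict Implicit.
Unset Printing Implicit Defensive.
Import Order.TTheory GRing.Theory Num.Theory.
Import numFieldNormedType.Exports.
Local Open Scope classical_set_scope.
Local Open Scope ring_scope.

(* Power series methods and statistical convergence *)

Definition radius_of_convergence (R : realType) (s : nat -> R) : \bar R :=
  ereal_sup [set `|t|%:E | t in [set t : R | cvgn (pseries s t)]].

Definition power_series_method (R : realType) (s : nat -> R) : Prop :=
  [/\ 0 < s 0%N, forall j, 0 <= s j & (0 < radius_of_convergence s)%E].

(* The filter of t -> l^-. The value at l = -oo is irrelevant: the radius of
   convergence of a power series method is positive. When 0 < l, the condition
   0 < t holds eventually along this filter. *)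
Definition ereal_at_left (R : realType) (l : \bar R) : set_system R :=
  match l with
  | r%:E => r^'-
  | +oo%E => pinfty_nbhs R
  | -oo%E => ninfty_nbhs R
  end.

Definition to_radius (R : realType) (s : nat -> R) : set_system R :=
  ereal_at_left (radius_of_convergence s).

Definition regular_method (R : realType) (s : nat -> R) : Prop :=
  forall j, s j * t ^+ j / limn (pseries s t) @[t --> to_radius s] --> (0 : R).

(* "The P-density of E exists and equals d." *)
Definition has_density (R : realType) (s : nat -> R) (E : set nat) (d : R)
    : Prop :=
  (limn (pseries s t))^-1 * \big[+%R/0]_(0 <= j <oo | j \in E) (s j * t ^+ j)
    @[t --> to_radius s] --> d.

Definition st_cvg (R : realType) (s : nat -> R) (u : nat -> R) (L : R) : Prop :=
  forall e : R, 0 < e -> has_density s [set j | e <= `|u j - L|] 0.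

(* Function spaces on [a, b]. A function on [a, b] is represented by a total
   function R -> R whose values outside [a, b] are irrelevant. *)

Definition C0_on (R : realType) (a b : R) (f : R -> R) : Prop :=
  {within `[a, b], continuous f}.

(* The supremum is the real-valued one, hence meaningful for functions that
   are bounded on [a, b]. *)
Definition sup_norm (R : realType) (a b : R) (f : R -> R) : R :=
  sup [set `|f x| | x in `[a, b]].

(* Derivative of the restriction of f to [a, b]: two-sided inside, one-sided
   at the endpoints. *)
Definition diff_quotient (R : realType) (f : R -> R) (x y : R) : R :=
  (f y - f x) / (y - x).

Definition derivable_on (R : realType) (a b : R) (f : R -> R) : Prop :=
  forall x, x \in `[a, b] ->
    cvg (diff_quotient f x y @[y --> within `[a, b] x^']).

Definition deriv_on (R : realType) (a b : R) (f : R -> R) (x : R) : R :=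
  lim (diff_quotient f x y @[y --> within `[a, b] x^']).

Definition derivn_on (R : realType) (a b : R) (n : nat) (f : R -> R) : R -> R :=
  iter n (deriv_on a b) f.

Definition Cr_on (R : realType) (a b : R) (r : nat) (f : R -> R) : Prop :=
  (forall n, (n < r)%N -> derivable_on a b (derivn_on a b n f)) /\
  (forall n, (n <= r)%N -> C0_on a b (derivn_on a b n f)).

Definition Lip_on (R : realType) (a b M alpha : R) (f : R -> R) : Prop :=
  C0_on a b f /\
  forall x y, x \in `[a, b] -> y \in `[a, b] ->
    `|f x - f y| <= M * `|x - y| `^ alpha.

(* Operators *)

(* A positive linear operator C[a,b] -> C[a,b]. The second clause says that T
   is well defined on functions on [a, b]. *)
Definition positive_linear_operator (R : realType) (a b : R)
    (T : (R -> R) -> R -> R) : Prop :=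
  [/\ forall f, C0_on a b f -> C0_on a b (T f),
      forall f g, C0_on a b f -> C0_on a b g ->
        {in `[a, b], f =1 g} -> {in `[a, b], T f =1 T g},
      forall (c : R) f g, C0_on a b f -> C0_on a b g ->
        {in `[a, b], T (fun y => c * f y + g y) =1
                     (fun x => c * T f x + T g x)} &
      forall f, C0_on a b f -> {in `[a, b], forall x, 0 <= f x} ->
        {in `[a, b], forall x, 0 <= T f x}].

(* T(f; x) = \sum_k rho_k(x) f(x_k), with convergence of the series (not
   necessarily absolute) for every f in C[a,b] and x in [a,b]. *)
Definition series_operator (R : realType) (a b : R)
    (rho : nat -> R -> R) (node : nat -> R) (T : (R -> R) -> R -> R) : Prop :=
  forall f, C0_on a b f -> {in `[a, b], forall x,
    series (fun k => rho k x * f (node k)) @ \oo --> T f x}.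

Definition taylor_operator (R : realType) (a b : R)
    (rho : nat -> R -> R) (node : nat -> R) (r : nat) (f : R -> R) (x : R) : R :=
  \big[+%R/0]_(0 <= k <oo) \sum_(nu < r.+1)
    (rho k x * derivn_on a b nu f (node k) * ((x - node k) ^+ nu / nu`!%:R)).

(* Main.v *)
(** The Taylor sum F_x(y) = \sum_(nu <= r) psi^(nu)(y) (x - y)^nu / nu! is
    continuous in y, so the Taylor operator at x is G_j(F_x; x). As the
    derivatives are bounded, F_x(y) is close to psi(x) for y close to x,
    uniformly in x; hence |F_x(y) - psi(x)| <= e + K (x - y)^2 with K depending
    only on e. Positivity turns this into a bound of |G_j(F_x; x) - psi(x)| by e
    plus K times the second moment G_j((x - y)^2; x), which the test functions
    y and y^2 control. So each set of bad indices j for the Taylor operator is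
    contained in the union of two sets of density zero. *)
Require Import Defs.
From mathcomp Require Import all_boot all_order all_algebra.
From mathcomp Require Import all_classical all_reals all_analysis.
From mathcomp Require Import ring lra.
Import Order.TTheory GRing.Theory Num.Theory.
Import numFieldNormedType.Exports.
Local Open Scope classical_set_scope.
Local Open Scope ring_scope.

(** * Power series methods and sets of density zero *)

Lemma cvgn_pseries_in_radius {R : realType} {s : nat -> R} {t : R} :
  (`|t|%:E < radius_of_convergence s)%E -> cvgn (pseries s t).
Proof.
move=> /ereal_sup_gt[_ [u su <-]]; rewrite lte_fin => tu.
exact: is_cvg_pseries_inside su tu.
Qed.

Lemma to_radius_filter {R : realType} (s : nat -> R) : Filter (to_radius s).
Proof.
by rewrite /to_radius; case: radius_of_convergence => [l||] /=; apply: _.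
Qed.

Lemma near_to_radius {R : realType} {s : nat -> R} : power_series_method s ->
  \forall t \near to_radius s, 0 < t /\ cvgn (pseries s t).
Proof.
move=> [_ _ rad_gt0].
have FF := to_radius_filter s.
suff near_lt : \forall t \near to_radius s,
    0 < t /\ (t%:E < radius_of_convergence s)%E.
  apply: filterS near_lt => t [t_gt0 tR]; split=> //.
  by apply: cvgn_pseries_in_radius; rewrite gtr0_norm.
rewrite /to_radius.
case: radius_of_convergence rad_gt0 FF => [l||] //= l_gt0 FF.
- near=> t; rewrite lte_fin; split; near: t; first exact: nbhs_left_gt.
  exact: nbhs_left_lt.
- near=> t; rewrite ltry; split=> //; near: t; exact: nbhs_pinfty_gt.
Unshelve. all: by end_near. Qed.

(** Padding with zeros turns a sum restricted to [E] into an ordinary series, to which the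
    comparison lemmas for series apply. *)
Lemma bigE_series {R : realType} (E : set nat) (u : nat -> R) :
  \big[+%R/0]_(0 <= j <oo | j \in E) u j =
  limn (series (fun j => if j \in E then u j else 0)).
Proof.
by congr (lim (_ @ \oo)); apply/funext => n; rewrite /series /= big_mkcond.
Qed.

(** For [t] positive and inside the radius of convergence all terms are non-negative and all series
    converge, so the ratio for [E] is squeezed between 0 and the sum of the ratios for [A] and
    [B]. *)
Lemma has_density0_sub2 {R : realType} {s : nat -> R} {A B E : set nat} :
  power_series_method s -> E `<=` A `|` B ->
  has_density s A 0 -> has_density s B 0 -> has_density s E 0.
Proof.
move=> hP EAB dA dB; have [s0_gt0 s_ge0 _] := hP.
have F := to_radius_filter s.
have := cvgD dA dB; rewrite addr0 => dAB.
apply: (squeeze_cvgr _ (cvg_cst 0) (dAB F)).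
apply: filterS (near_to_radius hP) => t [t_gt0 st].
have u_ge0 j : 0 <= s j * t ^+ j by rewrite mulr_ge0 ?exprn_ge0 // ltW.
pose u (D : set nat) j := if j \in D then s j * t ^+ j else 0.
have uD_ge0 D j : 0 <= u D j by rewrite /u; case: ifP => _; [exact: u_ge0|].
have cu D : cvgn (series (u D)).
  apply: (series_le_cvg (uD_ge0 D) u_ge0 _ st) => j.
  by rewrite /u; case: ifP => _ //; exact: u_ge0.
have s_lim_ge0 : 0 <= limn (pseries s t).
  apply: limr_ge => //; apply: nearW => n.
  by apply: sumr_ge0 => j _; exact: u_ge0.
rewrite /GRing.add /= !bigE_series -/(u A) -/(u B) -/(u E) -mulrDr.
apply/andP; split.
  rewrite mulr_ge0 ?invr_ge0 //; apply: limr_ge; first exact: cu.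
  by apply: nearW => n; apply: sumr_ge0.
rewrite ler_wpM2l ?invr_ge0 // -lim_seriesD //.
apply: lim_series_le => //.
  rewrite (_ : series _ = series (u A) \+ series (u B)).
    exact: is_cvgD.
  by apply/funext => n; rewrite /series /= -big_split.
move=> j; rewrite {1}/u; case: ifPn => [/set_mem/EAB[jA|jB]|_].
- by rewrite /GRing.add /= {1}/u mem_set // lerDl.
- by rewrite /GRing.add /= {2}/u mem_set // lerDr.
- by rewrite addr_ge0.
Qed.

(** * Continuous functions on a compact interval and the supremum norm *)

Lemma C0_on_cst {R : realType} (a b k : R) : C0_on a b (fun=> k).
Proof. by apply: continuous_subspaceT => y; exact: cst_continuous. Qed.

Lemma C0_on_id {R : realType} (a b : R) : C0_on a b id.
Proof. by apply: continuous_subspaceT => y; exact: cvg_id. Qed.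

Lemma C0_on_exprn {R : realType} (a b : R) (n : nat) :
  C0_on a b (fun y => y ^+ n).
Proof. by apply: continuous_subspaceT => y; exact: exprn_continuous. Qed.

Lemma C0_on_mul {R : realType} {a b : R} {f g : R -> R} :
  C0_on a b f -> C0_on a b g -> C0_on a b (fun y => f y * g y).
Proof. by move=> cf cg y; apply: continuousM; [exact: cf|exact: cg]. Qed.

Lemma C0_on_bounded {R : realType} {a b : R} {f : R -> R} :
  a <= b -> C0_on a b f ->
  exists2 B, 0 <= B & forall x, x \in `[a, b] -> `|f x| <= B.
Proof.
move=> ab cf; have [c _ fc] := EVT_max ab cf; have [d _ fd] := EVT_min ab cf.
exists (`|f c| + `|f d|); first by rewrite addr_ge0.
move=> x xab; rewrite ler_norml; have := fc x xab; have := fd x xab.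
have := ler_norm (f c); have := ler_norm (- f d); rewrite normrN.
by have := normr_ge0 (f c); have := normr_ge0 (f d); lra.
Qed.

(** This is the Heine-Cantor theorem, from compactness in its near-covering form: a property that
    holds around each point for all small [d] holds on the whole interval for all small [d]. *)
Lemma C0_on_uniform {R : realType} {a b : R} {f : R -> R} {e : R} :
  C0_on a b f -> 0 < e ->
  exists2 d, 0 < d & forall x y, x \in `[a, b] -> y \in `[a, b] ->
    `|x - y| < d -> `|f x - f y| <= e.
Proof.
move=> cf e_gt0.
(* The premise on [x] stays inside [P] because [P] is tested on full neighbourhoods of [x0], which
   may leave the interval. *)
pose P d x := forall y, x \in `[a, b] -> y \in `[a, b] ->
  `|x - y| < d -> `|f x - f y| <= e.
have near_d : \forall d \near (0 : R)^'+, `[a, b] `<=` P d.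
  have /compact_near_coveringP := @segment_compact R a b.
  apply => x0 x0ab.
  have /subspace_continuousP/(_ x0 x0ab)/cvgrPdist_lt/(_ (e / 2)) := cf.
  move=> /(_ (divr_gt0 e_gt0 (ltr0n _ 2))).
  rewrite near_withinE => -[/= d d_gt0 hd].
  (* Halving the radius keeps both [x] and [y] within [d] of [x0]; each of them then contributes an
     error below [e / 2]. *)
  exists (ball x0 (d / 2), [set t | t < d / 2]) => /=.
    split; first by apply: nbhsx_ballx; rewrite divr_gt0.
    by apply: nbhs_right_lt; rewrite divr_gt0.
  move=> [x t] /= [x0x td] y xab yab xy.
  rewrite /ball /= in x0x hd.
  have x0x' := hd x; have x0y' := hd y; move: x0x' x0y'.
  have h1 : `|x0 - x| < d by lra.
  have h2 : `|x0 - y| < d by have := ler_distD x x0 y; lra.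
  move=> /(_ h1 xab) + /(_ h2 yab); rewrite /from_subspace => e1 e2.
  by have := ler_distD (f x0) (f x) (f y); rewrite (distrC (f x) (f x0)); lra.
near (0 : R)^'+ => d.
have d_gt0 : 0 < d by near: d; exact: nbhs_right_gt.
have Pd : `[a, b] `<=` P d by near: d.
by exists d => // x y xab; exact: Pd.
Unshelve. all: by end_near. Qed.

Lemma le_sup_norm {R : realType} {a b : R} {f : R -> R} {x : R} :
  C0_on a b f -> x \in `[a, b] -> `|f x| <= sup_norm a b f.
Proof.
move=> cf xab.
have ab : a <= b by move: xab; rewrite in_itv /= => /andP[]; exact: le_trans.
have [B _ hB] := C0_on_bounded ab cf.
apply: ub_le_sup; last by exists x.
by exists B => _ [y yab <-]; exact: hB.
Qed.

(** The pointwise bound itself makes the supremum meaningful, so the lemma applies to the error of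
    the Taylor operator, whose continuity in [x] is not established. *)
Lemma sup_norm_le {R : realType} {a b : R} {f : R -> R} {B : R} :
  a <= b -> (forall x, x \in `[a, b] -> `|f x| <= B) ->
  0 <= sup_norm a b f <= B.
Proof.
move=> ab hB; have aab : a \in `[a, b] by rewrite in_itv /= lexx.
apply/andP; split.
  apply: (le_trans (normr_ge0 (f a))); apply: ub_le_sup; last by exists a.
  by exists B => _ [y yab <-]; exact: hB.
by apply: ge_sup; [exists `|f a|, a | move=> _ [y yab <-]; exact: hB].
Qed.

(** * Positive linear operators and second moments *)

Lemma positive_linear_operator_quadratic {R : realType} {a b : R}
    {T : (R -> R) -> R -> R} {f : R -> R} {x : R} (c A B C : R) :
  positive_linear_operator a b T -> T (fun=> 1) x = 1 ->
  C0_on a b f -> x \in `[a, b] ->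
  (forall y, y \in `[a, b] -> 0 <= c * f y + (A + B * y + C * y ^+ 2)) ->
  0 <= c * T f x + (A + B * T id x + C * T (fun y => y ^+ 2) x).
Proof.
move=> [_ _ linT posT] T1 cf xab q_ge0.
have c1 (k : R) : C0_on a b (fun=> k) by exact: C0_on_cst.
have cid : C0_on a b id by exact: C0_on_id.
have csq : C0_on a b (fun y => y ^+ 2) by exact: C0_on_exprn.
have cD (k : R) g h : C0_on a b g -> C0_on a b h ->
    C0_on a b (fun y => k * g y + h y).
  move=> cg ch; apply: (@within_continuousD _ _ _ _ (fun z => k * g z) h) => //.
  exact: (C0_on_mul (c1 k)).
(* T is homogeneous only in combinations [c * f + g], so the constant [A] is
   written as [(A - 1) * 1 + 1]. *)
pose g0 (y : R) : R := (A - 1) * 1 + 1.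
pose g1 y := B * y + g0 y; pose g2 y := C * y ^+ 2 + g1 y.
have cg0 : C0_on a b g0 by exact: cD.
have cg1 : C0_on a b g1 by exact: cD.
have cg2 : C0_on a b g2 by exact: cD.
have := posT _ (cD c _ _ cf cg2) _ x xab.
rewrite (linT c _ _ cf cg2) // (linT C _ _ csq cg1) // (linT B _ _ cid cg0) //.
rewrite (linT (A - 1) _ _ (c1 1) (c1 1)) // T1 => h.
rewrite (_ : A + _ + _ = C * T (fun y => y ^+ 2) x +
  (B * T id x + ((A - 1) * 1 + 1))); last by ring.
apply: h => y /q_ge0; rewrite /g2 /g1 /g0.
by rewrite (_ : C * _ + _ = A + B * y + C * y ^+ 2)//; ring.
Qed.

(** Positivity is applied to [e + K * (x - y) ^+ 2] plus and minus [f y - v]. The factor of [K] in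
    the conclusion is the second moment of [T] at [x], regrouped into the errors on the test
    functions. *)
Lemma positive_linear_operator_dist {R : realType} {a b : R}
    {T : (R -> R) -> R -> R} {f : R -> R} {x : R} (e K v : R) :
  positive_linear_operator a b T -> T (fun=> 1) x = 1 ->
  C0_on a b f -> x \in `[a, b] ->
  (forall y, y \in `[a, b] -> `|f y - v| <= e + K * (x - y) ^+ 2) ->
  `|T f x - v| <=
    e + K * ((T (fun y => y ^+ 2) x - x ^+ 2) - 2 * x * (T id x - x)).
Proof.
move=> hT T1 cf xab fv.
(* The coefficients come from expanding [e + K * (x - y) ^+ 2 + v] in powers of [y]; [lo] has [- v]
   instead. *)
have up := positive_linear_operator_quadratic (-1) (e + K * x ^+ 2 + v)
  (- 2 * K * x) K hT T1 cf xab.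
have lo := positive_linear_operator_quadratic 1 (e + K * x ^+ 2 - v)
  (- 2 * K * x) K hT T1 cf xab.
rewrite ler_norml; apply/andP; split.
  suff : 0 <= 1 * T f x + (e + K * x ^+ 2 - v + - 2 * K * x * T id x +
    K * T (fun y => y ^+ 2) x) by rewrite !expr2; lra.
  apply: lo => y /fv; rewrite ler_norml => /andP[h _].
  by rewrite !expr2 in h *; lra.
suff : 0 <= -1 * T f x + (e + K * x ^+ 2 + v + - 2 * K * x * T id x +
  K * T (fun y => y ^+ 2) x) by rewrite !expr2; lra.
apply: up => y /fv; rewrite ler_norml => /andP[_ h].
by rewrite !expr2 in h *; lra.
Qed.

(** * Quadratic bounds for continuous functions and Taylor sums *)

Lemma C0_on_quadratic {R : realType} {a b : R} {f : R -> R} {e : R} :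
  a <= b -> C0_on a b f -> 0 < e ->
  exists2 K, 0 <= K & forall x y, x \in `[a, b] -> y \in `[a, b] ->
    `|f x - f y| <= e + K * (x - y) ^+ 2.
Proof.
move=> ab cf e_gt0; have [B B_ge0 fB] := C0_on_bounded ab cf.
have [d d_gt0 hd] := C0_on_uniform cf e_gt0.
have d2_gt0 : 0 < d ^+ 2 by rewrite exprn_gt0.
have K_ge0 : 0 <= 2 * B / d ^+ 2 by rewrite divr_ge0 ?mulr_ge0 // ltW.
exists (2 * B / d ^+ 2) => // x y xab yab.
(* Close points are handled by uniform continuity. For distant ones [(x - y) ^+ 2 / d ^+ 2] is at
   least 1, so the quadratic term dominates the trivial bound [2 * B]. *)
have [xy|xy] := ltP `|x - y| d.
  by rewrite (le_trans (hd _ _ xab yab xy)) // lerDl mulr_ge0 // sqr_ge0.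
have : `|f x - f y| <= 2 * B.
  by have := ler_normB (f x) (f y); have := fB _ xab; have := fB _ yab; lra.
move=> /le_trans; apply.
have : 2 * B <= 2 * B / d ^+ 2 * (x - y) ^+ 2; last by lra.
rewrite -mulrA ler_peMr ?mulr_ge0 // mulrC ler_pdivlMr // mul1r.
by rewrite -[leRHS]real_normK ?num_real // lerXn2r // nnegrE // ltW.
Qed.

(** The Taylor polynomial of [psi] expanded at [y] and evaluated at [x]. The expansion point comes
    last, since the operators act on this variable. *)
Definition taylor_sum {R : realType} (a b : R) (r : nat) (psi : R -> R)
    (x y : R) : R :=
  \sum_(nu < r.+1) derivn_on a b nu psi y * ((x - y) ^+ nu / nu`!%:R).

Lemma C0_on_sum {R : realType} {a b : R} (n : nat) (F : 'I_n -> R -> R) :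
  (forall i, C0_on a b (F i)) -> C0_on a b (fun y => \sum_(i < n) F i y).
Proof.
move=> cF; apply: (@continuous_big R^o _ _ _ _ _ (subspace `[a, b])).
  exact: add_continuous.
by move=> i _; exact: cF.
Qed.

Lemma C0_on_taylor_sum {R : realType} {a b : R} {r : nat} {psi : R -> R} x :
  Cr_on a b r psi -> C0_on a b (taylor_sum a b r psi x).
Proof.
move=> [_ cpsi]; apply: C0_on_sum => nu; apply: C0_on_mul.
  by apply: cpsi; rewrite -ltnS.
apply: continuous_subspaceT => y; apply: cvgM; last exact: cvg_cst.
apply: (@continuous_comp _ _ _ (fun y => x - y) (fun z => z ^+ nu)).
  by apply: cvgB; [exact: cvg_cst|exact: cvg_id].
exact: exprn_continuous.
Qed.

Lemma taylor_sum_lipschitz {R : realType} {a b : R} {r : nat}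
    {psi : R -> R} : a <= b -> Cr_on a b r psi ->
  exists2 C, 0 <= C & forall x y, x \in `[a, b] -> y \in `[a, b] ->
    `|taylor_sum a b r psi x y - psi y| <= C * `|x - y|.
Proof.
move=> ab [_ cpsi].
(* The term of index 0 of the Taylor sum is [psi y]. Each later one contains a factor [x - y]; [g]
   bounds what remains, by [|x - y| <= b - a] and because factorials are at least 1. *)
pose g y := \sum_(nu < r) `|derivn_on a b nu.+1 psi y| * (b - a) ^+ nu.
have cg : C0_on a b g.
  apply: C0_on_sum => nu; apply: C0_on_mul; last exact: C0_on_cst.
  move=> y; apply: continuous_comp; last exact: norm_continuous.
  by apply: cpsi.
have [C C_ge0 gC] := C0_on_bounded ab cg.
exists C => // x y xab yab; rewrite /taylor_sum big_ord_recl /=.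
rewrite expr0 fact0 divr1 mulr1 addrAC subrr add0r.
apply: (le_trans (ler_norm_sum _ _ _)).
apply: (@le_trans _ _ (g y * `|x - y|)); last first.
  by rewrite ler_wpM2r // (le_trans (ler_norm _)) // gC.
rewrite /g mulr_suml; apply: ler_sum => nu _.
rewrite /bump leq0n add1n normrM -mulrA ler_wpM2l //.
rewrite normrM normrX exprSr normfV normr_nat.
rewrite ler_pdivrMr ?ltr0n ?fact_gt0 //.
rewrite -[leLHS]mulr1 ler_pM ?mulr_ge0 ?exprn_ge0 ?ler1n ?fact_gt0 //.
rewrite ler_wpM2r // lerXn2r ?nnegrE ?subr_ge0 //.
move: xab yab; rewrite !in_itv /= => /andP[? ?] /andP[? ?].
by rewrite ler_norml; apply/andP; split; lra.
Qed.

Lemma taylor_sum_quadratic {R : realType} {a b : R} {r : nat} {psi : R -> R}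
    {e : R} : a <= b -> Cr_on a b r psi -> 0 < e ->
  exists2 K, 0 <= K & forall x y, x \in `[a, b] -> y \in `[a, b] ->
    `|taylor_sum a b r psi x y - psi x| <= e + K * (x - y) ^+ 2.
Proof.
move=> ab hpsi e_gt0; have [C C_ge0 hC] := taylor_sum_lipschitz ab hpsi.
have cpsi : C0_on a b psi by case: hpsi => _ /(_ 0%N); exact.
have [K K_ge0 hK] := C0_on_quadratic ab cpsi (divr_gt0 e_gt0 (ltr0n _ 2)).
have K'_ge0 : 0 <= C ^+ 2 / (2 * e).
  by rewrite divr_ge0 ?sqr_ge0 // mulr_ge0 // ltW.
exists (C ^+ 2 / (2 * e) + K); first exact: addr_ge0.
move=> x y xab yab.
(* A linear bound is traded for a quadratic one, as only second moments are controlled. The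
   difference of the two sides is a square divided by [2 * e]. *)
have amgm : C * `|x - y| <= e / 2 + C ^+ 2 / (2 * e) * (x - y) ^+ 2.
  rewrite -(real_normK (num_real (x - y))) -subr_ge0.
  rewrite (_ : _ - _ = (C * `|x - y| - e) ^+ 2 / (2 * e)).
    by rewrite divr_ge0 ?sqr_ge0 // mulr_ge0 // ltW.
  by field; rewrite gt_eqF.
have := ler_distD (psi y) (taylor_sum a b r psi x y) (psi x).
have := hC _ _ xab yab; have := hK _ _ xab yab.
rewrite (distrC (psi x)) mulrDl; lra.
Qed.

(** The Taylor sum is continuous in [y], so the series representation of [T] applies to it, and the
    partial sums agree term by term. *)
Lemma taylor_operatorE {R : realType} {a b : R} {r : nat} {psi : R -> R}
    {rho : nat -> R -> R} {node : nat -> R} {T : (R -> R) -> R -> R} {x : R} :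
  series_operator a b rho node T -> Cr_on a b r psi -> x \in `[a, b] ->
  taylor_operator a b rho node r psi x = T (taylor_sum a b r psi x) x.
Proof.
move=> hT hpsi xab; have := hT _ (C0_on_taylor_sum x hpsi) x xab.
move=> /cvg_lim <- //; congr (lim (_ @ \oo)); apply/funext => n.
rewrite /series /=; apply: eq_bigr => k _.
by rewrite /taylor_sum mulr_sumr; apply: eq_bigr => nu _; rewrite -mulrA.
Qed.

(** * Statistical convergence of the Taylor operators *)

Theorem corollary1 (R : realType) (s : nat -> R)
  (hP : power_series_method s) (hreg : regular_method s)
  (r : nat) (hr : (1 <= r)%N) (a b : R) (hab : a < b)
  (G : nat -> (R -> R) -> R -> R)
  (rho : nat -> nat -> R -> R) (node : nat -> nat -> R)
  (hpos : forall j, positive_linear_operator a b (G j))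
  (hnode : forall j k, node j k \in `[a, b])
  (hform : forall j, series_operator a b (rho j) (node j) (G j))
  (hone : forall j x, x \in `[a, b] -> G j (fun=> 1) x = 1)
  (h1 : st_cvg s (fun j => sup_norm a b (fun x => G j (fun=> 1) x - 1)) 0)
  (h2 : st_cvg s (fun j => sup_norm a b (fun x => G j (fun y => y) x - x)) 0)
  (h3 : st_cvg s
    (fun j => sup_norm a b (fun x => G j (fun y => y ^+ 2) x - x ^+ 2)) 0)
  (psi : R -> R) (hpsi : Cr_on a b r psi)
  (M alpha : R) (hM : 0 < M) (halpha0 : 0 < alpha) (halpha1 : alpha <= 1)
  (hLip : Lip_on a b M alpha (derivn_on a b r psi)) :
  st_cvg s
    (fun j => sup_norm a b
      (fun x => taylor_operator a b (rho j) (node j) r psi x - psi x)) 0.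
Proof.
have ab := ltW hab.
have cid : C0_on a b id by exact: C0_on_id.
have csq : C0_on a b (fun y => y ^+ 2) by exact: C0_on_exprn.
have csub f g : C0_on a b f -> C0_on a b g -> C0_on a b (fun y => f y - g y).
  by move=> cf cg y; apply: continuousB; [exact: cf|exact: cg].
have cG j f : C0_on a b f -> C0_on a b (G j f).
  by case: (hpos j) => + _ _ _; exact.
move=> e e_gt0.
have e4_gt0 : 0 < e / 4 by rewrite divr_gt0.
have [K K_ge0 hK] := taylor_sum_quadratic ab hpsi e4_gt0.
pose c := `|a| + `|b|.
have c_ge0 : 0 <= c by rewrite addr_ge0.
have xc x : x \in `[a, b] -> `|x| <= c.
  rewrite in_itv /= /c ler_norml => /andP[? ?].
  have := ler_norm (- a); rewrite normrN; have := ler_norm b.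
  by have := normr_ge0 a; have := normr_ge0 b; lra.
(* These thresholds make [(K + 1) * (2 * c + 1) * d2] and [(K + 1) * d3] both equal to [e / 4].
   Adding 1 keeps the denominators positive when [K] or [c] vanishes. *)
pose d2 := e / 4 / ((K + 1) * (2 * c + 1)); pose d3 := e / 4 / (K + 1).
have K1_gt0 : 0 < K + 1 by lra.
have c1_gt0 : 0 < 2 * c + 1 by lra.
have d2_gt0 : 0 < d2 by rewrite divr_gt0 // mulr_gt0.
have d3_gt0 : 0 < d3 by rewrite divr_gt0.
apply: (has_density0_sub2 hP _ (h2 d2 d2_gt0) (h3 d3 d3_gt0)) => j /= ej.
(* If both test errors at [j] lie below their thresholds, the Taylor error is at most three quarters
   of [e], against [ej]. *)
apply: contrapT => /not_orP[/negP + /negP]; rewrite -!ltNge !subr0 => u2 u3.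
set u := sup_norm a b _ in ej.
suff : 0 <= u <= e / 4 + (e / 4 + e / 4).
  by move=> /andP[? ?]; move: ej; rewrite subr0 ger0_norm //; lra.
apply: sup_norm_le => // x xab; rewrite (taylor_operatorE (hform j) hpsi xab).
have := positive_linear_operator_dist (e / 4) K (psi x) (hpos j) (hone j x xab)
  (C0_on_taylor_sum x hpsi) xab (fun y yab => hK x y xab yab).
move=> /le_trans; apply; rewrite lerD2l.
(* Continuity of the images under [G j] makes the suprema finite, so they dominate the pointwise
   errors. *)
have n2 := le_sup_norm (csub _ _ (cG j _ cid) cid) xab.
have n3 := le_sup_norm (csub _ _ (cG j _ csq) csq) xab.
have {u2}n2 : `|G j id x - x| <= d2.
  exact: (le_trans n2 (le_trans (ler_norm _) (ltW u2))).
have {u3}n3 : `|G j (fun y => y ^+ 2) x - x ^+ 2| <= d3.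
  exact: (le_trans n3 (le_trans (ler_norm _) (ltW u3))).
have p2 : - (2 * x * (G j id x - x)) <= (2 * c + 1) * d2.
  rewrite -mulNr (le_trans (ler_norm _)) // normrM normrN normrM.
  by rewrite ler_pM ?mulr_ge0 // normr_nat; have := xc x xab; lra.
have p3 := le_trans (ler_norm _) n3.
apply: (@le_trans _ _ ((K + 1) * (d3 + (2 * c + 1) * d2))).
  apply: (@le_trans _ _ (K * (d3 + (2 * c + 1) * d2))).
    by rewrite ler_wpM2l //; lra.
  have : 0 <= (2 * c + 1) * d2 by rewrite mulr_ge0 // ltW.
  by move=> h; rewrite ler_wpM2r; lra.
suff -> : (K + 1) * (d3 + (2 * c + 1) * d2) = e / 4 + e / 4 by [].
by rewrite /d3 /d2; field; rewrite !gt_eqF.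
Qed.
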